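(* There exist a topological dynamical system $(X,f)$ and a point $x\in X$ such that $x$ is $\mathscr{F}_{\mathrm{ps}}\text{-}\mathrm{PR}_0$ but $x$ is not $\mathscr{F}_{\mathrm{pubd}}\text{-}\mathrm{PR}_0$.
   Context: $\mathbb{N}=\{1,2,\dots\}$, $\mathbb{N}_0=\{0,1,2,\dots\}$. A topological dynamical system (TDS) is a pair $(X,f)$ with $X$ a nontrivial (more than one point) compact metric space and $f\colon X\to X$ continuous. $N_f(x,U)=\{n\in\mathbb{N}: f^n(x)\in U\}$. A set $A\subseteq\mathbb{N}_0$ is thick if it contains arbitrarily long runs of consecutive integers; syndetic if there is $L\in\mathbb{N}$ with $[i,i+L]\cap A\ne\varnothing$ for all $i\in\mathbb{N}_0$; piecewise syndetic if it is the intersection of a syndetic set and a thick set. Its upper Banach density is $BD^*(A)=\limsup_{n-m\to\infty}\frac{\#(A\cap[m,n])}{n-m+1}$. $\mathscr{F}_{\mathrm{ps}}$ is the family of piecewise syndetic subsets of $\mathbb{N}_0$ and $\mathscr{F}_{\mathrm{pubd}}$ the family of subsets of $\mathbb{N}_0$ with positive upper Banach density. For such a family $\mathscr{F}$, a point $x$ of $(X,f)$ is $\mathscr{F}$-recurrent if $N_f(x,U)\in\mathscr{F}$ for every neighborhood $U$ of $x$, and recurrent if $N_f(x,U)\neq\varnothing$ for every neighborhood $U$ of $x$. A point $x\in X$ is $\mathscr{F}\text{-}\mathrm{PR}_0$ if for every TDS $(Y,g)$ with zero topological entropy and every $\mathscr{F}$-recurrent point $y\in Y$, the pair $(x,y)$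 is recurrent for $(X\times Y,f\times g)$. *)

(* Defs.v *)
From HB Require Import structures.
From mathcomp Require Import all_boot all_order all_algebra finmap.
From mathcomp Require Import all_classical all_reals all_analysis.

Set Implicit Arguments.
Unset Strict Implicit.
Unset Printing Implicit Defensive.

Import Order.TTheory GRing.Theory Num.Theory.

Local Open Scope classical_set_scope.
Local Open Scope ring_scope.

(* Families of subsets of {0, 1, 2, ...} *)

Definition thick (A : set nat) : Prop :=
  forall L : nat, exists i : nat, forall j : nat, (j < L)%N -> A (i + j)%N.

Definition syndetic (A : set nat) : Prop :=
  exists2 L : nat, (0 < L)%N &
    forall i : nat, exists2 j : nat, (i <= j <= i + L)%N & A j.

Definition piecewise_syndetic (A : set nat) : Prop :=
  exists S T : set nat, [/\ syndetic S, thick T & A = S `&` T].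

(* The filter on pairs (m, n) along which n - m tends to infinity. *)
Definition gap_infty : set_system (nat * nat) :=
  filter_from [set: nat] (fun N => [set mn | (mn.1 + N <= mn.2)%N]).

Definition upper_banach_density (R : realType) (A : set nat) : \bar R :=
  limf_esup
    (fun mn : nat * nat =>
       (#|` fset_set (A `&` [set k | (mn.1 <= k <= mn.2)%N])|%:R
         / (mn.2 - mn.1).+1%:R)%:E)
    gap_infty.

Definition F_ps : set (set nat) := [set A | piecewise_syndetic A].

Definition F_pubd (R : realType) : set (set nat) :=
  [set A | (0 < upper_banach_density R A)%E].

(* Dynamical systems *)

Definition is_tds (R : realType) (X : metricType R) (f : X -> X) : Prop :=
  [/\ compact [set: X], exists x y : X, x <> y & continuous f].

(* Return times are positive: n = 0 is excluded. *)
Definition return_times (X : Type) (f : X -> X) (x : X) (U : set X) : set nat :=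
  [set n | (0 < n)%N /\ U (iter n f x)].

Definition F_recurrent (F : set (set nat)) (X : topologicalType) (f : X -> X)
    (x : X) : Prop :=
  forall U : set X, nbhs x U -> F (return_times f x U).

Definition recurrent (X : topologicalType) (f : X -> X) (x : X) : Prop :=
  forall U : set X, nbhs x U -> return_times f x U !=set0.

Definition prod_map (X Y : Type) (f : X -> X) (g : Y -> Y) (p : X * Y) : X * Y :=
  (f p.1, g p.2).

(* Topological entropy, defined through open covers following Adler, Konheim
   and McAndrew. *)

Definition open_cover (X : topologicalType) (C : set (set X)) : Prop :=
  (forall V, C V -> open V) /\ cover C id = [set: X].

Definition subcover_sizes (X : Type) (C : set (set X)) : set nat :=
  [set k | exists D : set (set X),
     [/\ D `<=` C, (D #= `I_k)%card & cover D id = [set: X]]].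

(* The least cardinality of a subcover; the default value 0 is used only when
   there is no finite subcover. *)
Definition cover_number (X : Type) (C : set (set X)) : nat :=
  xget 0%N [set k | subcover_sizes C k /\
                    forall j, subcover_sizes C j -> (k <= j)%N].

(* The join of C, f^-1 C, ..., f^-(n-1) C. *)
Definition iterated_join (X : Type) (f : X -> X) (C : set (set X)) (n : nat) :
    set (set X) :=
  [set \bigcap_(i < n) (iter i f @^-1` V i) |
     V in [set V : nat -> set X | forall i, C (V i)]].

Definition cover_entropy (R : realType) (X : Type) (f : X -> X)
    (C : set (set X)) : \bar R :=
  limn_esup
    (fun n => (ln (cover_number (iterated_join f C n))%:R / n%:R : R)%:E).

Definition topological_entropy (R : realType) (X : topologicalType)
    (f : X -> X) : \bar R :=
  ereal_sup [set cover_entropy R f C | C in [set C | @open_cover X C]].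

Definition F_PR0 (R : realType) (F : set (set nat)) (X : metricType R)
    (f : X -> X) (x : X) : Prop :=
  forall (Y : metricType R) (g : Y -> Y), is_tds g ->
    topological_entropy R g = 0%E ->
    forall y : Y, F_recurrent F g y -> recurrent (prod_map f g) (x, y).

(* Main.v *)
Require Import Defs.
From mathcomp Require Import all_boot all_order all_algebra.
From mathcomp Require Import all_classical all_reals all_analysis.
From HB Require Import structures.
From mathcomp Require Import zify ring lra.

Set Implicit Arguments.
Unset Strict Implicit.
Unset Printing Implicit Defensive.

(* Both points are limits of words built in stages.  At stage k there is a
   finite family T_k of words, with a distinguished D_k in T_k, and
   T_{k+1} = { v_1 ... v_a u : v_i in T_k },  D_{k+1} = D_k^a u,
   where u = u_k lists all the words of T_k, and a = a_k is so much larger than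
   |u| that the fillers u_k, u_{k+1}, ... occupy a small proportion of the word.
   The point y is the limit of Y_0 = 1, Y_{k+1} = Y_k^a 0^|u|, and x is the limit
   of the D_k with the first letter changed to 1.  Thus the letter 1 occurs in x
   at positive times only inside the fillers, where y vanishes, and (x, y) is not
   recurrent.  The point y is a concatenation of the two words Y_k and 0^|Y_k|
   for every k, whence its orbit closure has zero entropy, and Y_k occurs in y
   with positive density.

   For the positive statement, let z be a piecewise syndetically recurrent point
   of a system of zero entropy.  On long intervals the visits of z to a
   neighbourhood have gaps at most L, and on intervals of length n only
   exp(o(n)) visiting patterns occur.  Every word of T_K occurs in x with bounded
   gaps, so it is enough to find one word of T_K in which a given prefix of x
   starts at a position of each of these patterns.  The words of T_k have several
   lengths, so the prefix can be shifted onto any given pattern within one word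
   of T_{k+1}; choosing the successive words of T_{k+1} greedily, each choice
   removes a fixed proportion of the remaining patterns.  The number of choices
   is proportional to n, so all the patterns are exhausted. *)

(** * Towers of words *)

Section Words.

Notation rep n s := (flatten (nseq n s)).

Definition concats (n : nat) (l : seq (seq bool)) : seq (seq bool) :=
  iter n (fun c => [seq w ++ v | w <- l, v <- c]) [:: [::]].

Lemma concatsS n l : concats n.+1 l = [seq w ++ v | w <- l, v <- concats n l].
Proof. by []. Qed.

Lemma rep_concats n l w : w \in l -> rep n w \in concats n l.
Proof.
move=> wl; elim: n => [|n IHn]; first by rewrite inE.
by rewrite concatsS; apply/allpairsP; exists (w, rep n w).
Qed.

Lemma cat_concats m n l v w :
  v \in concats m l -> w \in concats n l -> v ++ w \in concats (m + n) l.
Proof.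
move=> + wl; elim: m v => [|m IHm] v; first by rewrite inE => /eqP ->.
rewrite concatsS => /allpairsP[[p q] /= [pl ql ->]].
rewrite -catA; apply/allpairsP; exists (p, q ++ w).
by split=> //; apply: IHm.
Qed.

Lemma size_rep n (s : seq bool) : size (rep n s) = n * size s.
Proof. by rewrite size_flatten /shape map_nseq sumn_nseq mulnC. Qed.

Definition filler (d : seq bool) (l : seq (seq bool)) : seq bool :=
  rep (size d) (flatten l).

(* [stage k] is the pair (D_k, T_k).  The repetition in [filler] makes the size of
   the filler a multiple of the size of [d], which keeps the blocks of all the
   stages aligned in y; the word [:: false; false] provides a second length. *)
Fixpoint stage (k : nat) : seq bool * seq (seq bool) :=
  if k is k'.+1 then
    let u := filler (stage k').1 (stage k').2 in
    let a := 2 ^ k' * size u in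
    (rep a (stage k').1 ++ u, [seq v ++ u | v <- concats a (stage k').2])
  else ([:: false], [:: [:: false]; [:: true]; [:: false; false]]).

Definition dword k := (stage k).1.
Definition tower k := (stage k).2.
Definition fword k := filler (dword k) (tower k).
Definition mult k := 2 ^ k * size (fword k).
Definition height k := size (dword k).
Definition xword k := true :: behead (dword k).
Fixpoint yword k :=
  if k is k'.+1 then rep (mult k') (yword k') ++ nseq (size (fword k')) false
  else [:: true].

Lemma dwordS k : dword k.+1 = rep (mult k) (dword k) ++ fword k.
Proof. by []. Qed.

Lemma towerS k : tower k.+1 = [seq v ++ fword k | v <- concats (mult k) (tower k)].
Proof. by []. Qed.

Lemma ywordS k :
  yword k.+1 = rep (mult k) (yword k) ++ nseq (size (fword k)) false.
Proof. by []. Qed.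

Lemma heightS k : height k.+1 = mult k * height k + size (fword k).
Proof. by rewrite /height dwordS size_cat size_rep. Qed.

Lemma size_yword k : size (yword k) = height k.
Proof.
elim: k => // k IHk.
by rewrite ywordS size_cat size_rep size_nseq IHk heightS.
Qed.

Lemma dword_tower k : dword k \in tower k.
Proof.
elim: k => // k IHk; rewrite dwordS towerS; apply/mapP.
by exists (rep (mult k) (dword k)) => //; apply: rep_concats.
Qed.

Lemma size_tower_gt0 k : 0 < size (tower k).
Proof. by case: (tower k) (dword_tower k). Qed.

Lemma height_fword_gt0 k : (0 < height k) && (0 < size (fword k)).
Proof.
suff H j : 0 < height j -> 0 < size (fword j).
  elim: k => [|k /andP[_ u0]]; first by rewrite H.
  by rewrite H ?andbT // heightS addn_gt0 u0 orbT.
move=> hj; rewrite size_rep muln_gt0 hj /=.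
case/splitPr: (dword_tower j) => l1 l2.
by rewrite flatten_cat /= !size_cat !addn_gt0 hj orbT.
Qed.

Lemma height_gt0 k : 0 < height k.
Proof. by case/andP: (height_fword_gt0 k). Qed.

Lemma fword_gt0 k : 0 < size (fword k).
Proof. by case/andP: (height_fword_gt0 k). Qed.

Lemma mult_gt k : k < mult k.
Proof.
by rewrite (leq_trans (ltn_expl k (ltnSn 1))) // leq_pmulr // fword_gt0.
Qed.

Lemma mult_gt0 k : 0 < mult k.
Proof. exact: leq_trans (mult_gt k). Qed.

Lemma leq_heightS k : height k < height k.+1.
Proof.
rewrite heightS -addn1 leq_add ?fword_gt0 // leq_pmull //; exact: mult_gt0.
Qed.

Lemma height_gt k : k < height k.
Proof. by elim: k => // k IHk; apply: leq_ltn_trans (leq_heightS k). Qed.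

Lemma dvdn_fword k : height k %| size (fword k).
Proof. by rewrite size_rep dvdn_mulr. Qed.

Lemma repS n (s : seq bool) : rep n.+1 s = s ++ rep n s.
Proof. by []. Qed.

Lemma dword_cons k : dword k = head false (dword k) :: behead (dword k).
Proof. by have := height_gt0 k; rewrite /height; case: (dword k). Qed.

Lemma size_xword k : size (xword k) = height k.
Proof. by rewrite /height [in RHS]dword_cons. Qed.

Lemma xwordS k :
  xword k.+1 = xword k ++ rep (mult k).-1 (dword k) ++ fword k.
Proof.
rewrite /xword dwordS; have := mult_gt0 k.
case: (mult k) => // a _; rewrite repS {1}(dword_cons k) /=.
by rewrite -!catA.
Qed.

(** Stage 0 contains [[:: true]], and changing the first letter alters only the first factor
    [dword k] of [dword k.+1]. Hence x is, like the limit of the [dword k], a concatenation of tower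
    words. *)
Lemma xword_tower k : xword k \in tower k.
Proof.
elim: k => // k IHk; rewrite xwordS towerS; apply/mapP.
exists (xword k ++ rep (mult k).-1 (dword k)); last by rewrite catA.
have := @cat_concats 1 (mult k).-1 (tower k) (xword k) (rep (mult k).-1 (dword k)).
rewrite add1n prednK ?mult_gt0 //; apply; last exact/rep_concats/dword_tower.
by apply/allpairsP; exists (xword k, [::]); rewrite cats0 inE.
Qed.

(** The extra letter of [[:: false; false]] is carried from stage to stage by putting the longer
    word in place of the first [dword k]. *)
Lemma longer_word k : exists2 w, w \in tower k & size w = (height k).+1.
Proof.
elim: k => [|k [w wT sw]]; first by exists [:: false; false].
exists (w ++ rep (mult k).-1 (dword k) ++ fword k).
  rewrite towerS; apply/mapP.
  exists (w ++ rep (mult k).-1 (dword k)); last by rewrite catA.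
  have := @cat_concats 1 (mult k).-1 (tower k) w (rep (mult k).-1 (dword k)).
  rewrite add1n prednK ?mult_gt0 //; apply; last exact/rep_concats/dword_tower.
  by apply/allpairsP; exists (w, [::]); rewrite cats0 inE.
rewrite !size_cat size_rep sw heightS -/(height k).
by case: (mult k) (mult_gt0 k) => // a _; rewrite mulSn !addnA addSn.
Qed.

Definition disjoint_words (u v : seq bool) :=
  size u = size v /\ forall i, ~~ (nth false u i && nth false v i).

Lemma disjoint_cat u1 u2 v1 v2 :
  disjoint_words u1 v1 -> disjoint_words u2 v2 ->
  disjoint_words (u1 ++ u2) (v1 ++ v2).
Proof.
move=> [s1 h1] [s2 h2]; split; first by rewrite !size_cat s1 s2.
by move=> i; rewrite !nth_cat s1; case: ltnP.
Qed.

Lemma disjoint_dword_yword k : disjoint_words (dword k) (yword k).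
Proof.
elim: k => [|k IHk]; first by split=> // -[|[|]].
rewrite dwordS ywordS; apply: disjoint_cat.
  by elim: (mult k) => [|a IHa]; [split=> // i; rewrite nth_nil | exact: disjoint_cat].
by split=> [|i]; rewrite ?size_nseq // nth_nseq if_same andbF.
Qed.

(** * The limit points x and y *)

Definition limit_word (s : nat -> seq bool) (i : nat) := nth false (s i) i.

Lemma limit_wordE (s : nat -> seq bool) k i :
  (forall k, prefix (s k) (s k.+1)) -> (forall k, k < size (s k)) ->
  i < size (s k) -> limit_word s i = nth false (s k) i.
Proof.
move=> sP ss ik; rewrite /limit_word.
have pre m n : m <= n -> prefix (s m) (s n).
  elim: n => [|n IHn]; first by rewrite leqn0 => /eqP ->; exact: prefix_refl.
  rewrite leq_eqVlt => /orP[/eqP ->|/IHn mn]; first exact: prefix_refl.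
  exact: prefix_trans mn (sP n).
case: (leqP k i) => [/pre/prefixP[t ->]|/ltnW/pre/prefixP[t ->]].
  by rewrite nth_cat ik.
by rewrite nth_cat ss.
Qed.

Definition xpoint := limit_word xword.
Definition ypoint := limit_word yword.

Lemma xpointE k i : i < height k -> xpoint i = nth false (xword k) i.
Proof.
move=> ik; apply: limit_wordE; last by rewrite size_xword.
  by move=> j; rewrite xwordS prefix_prefix.
by move=> j; rewrite size_xword height_gt.
Qed.

Lemma ypointE k i : i < height k -> ypoint i = nth false (yword k) i.
Proof.
move=> ik; apply: limit_wordE; last by rewrite size_yword.
  move=> j; rewrite ywordS; have := mult_gt0 j.
  by case: (mult j) => // a _; rewrite repS -catA prefix_prefix.
by move=> j; rewrite size_yword height_gt.
Qed.

Lemma ypoint_false : exists i, ypoint i = false.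
Proof.
exists (mult 0 * height 0); rewrite (@ypointE 1).
  by rewrite ywordS nth_cat size_rep size_yword ltnn nth_nseq.
by rewrite heightS -[ltnLHS]addn0 ltn_add2l fword_gt0.
Qed.

Lemma xpoint_ypoint_disjoint i : 0 < i -> ~~ (xpoint i && ypoint i).
Proof.
move=> i0; rewrite (xpointE (height_gt i)) (ypointE (height_gt i)).
have [_ /(_ i)] := disjoint_dword_yword i.
(* [xword i] and [dword i] differ at most at position 0, which [i0] excludes. *)
by rewrite [in nth _ (dword i) i]dword_cons /xword; case: i i0.
Qed.


(** * Hitting sets of positions with bounded gaps *)

Definition dense_within (L : nat) (Q : pred nat) :=
  forall t, exists2 j, t <= j <= t + L & Q j.

(** The argument [s] is the absolute position of the first letter of [w]; it lets the factors of a
    concatenation be treated one after another. *)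
Definition hits (v w : seq bool) (s : nat) (Q : pred nat) :=
  has (fun j => Q (s + j) && prefix v (drop j w)) (iota 0 (size w)).

Lemma hitsP v w s (Q : pred nat) :
  reflect (exists p q, [/\ w = p ++ v ++ q, Q (s + size p) & size p < size w])
          (hits v w s Q).
Proof.
apply: (iffP hasP) => [[j]|[p [q [wE Qp pw]]]].
  rewrite mem_iota add0n => /= jw /andP[Qj /prefixP[q wE]].
  exists (take j w), q; rewrite -wE cat_take_drop size_take_min (minn_idPl _) //.
  exact: ltnW.
exists (size p); first by rewrite mem_iota.
by rewrite Qp wE drop_size_cat // prefix_prefix.
Qed.

Lemma hits_catl v w w' s (Q : pred nat) : hits v w s Q -> hits v (w ++ w') s Q.
Proof.
case/hitsP=> p [q [-> Qp pw]]; apply/hitsP; exists p, (q ++ w').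
by rewrite -!catA; split=> //; rewrite !catA size_cat -!catA ltn_addr.
Qed.

Lemma hits_catr v w w' s (Q : pred nat) :
  hits v w' (s + size w) Q -> hits v (w ++ w') s Q.
Proof.
case/hitsP=> p [q [-> Qp pw]]; apply/hitsP; exists (w ++ p), q.
by rewrite -!catA size_cat addnA; split=> //; rewrite size_cat ltn_add2l.
Qed.

(* A concatenation of [k] words of lengths [height k] and [height k + 1] can be
   given any length from [k * height k] to [k * height k + k]. *)
Lemma hits_tower k L s Q : L <= k -> dense_within L Q ->
  exists2 w, w \in tower k.+1 & hits (xword k) w s Q.
Proof.
move=> Lk /(_ (s + k * height k))[j /andP[j1 j2] Qj].
have [w wT sw] := longer_word k.
pose r := j - (s + k * height k).
have rk : r <= k by rewrite /r; lia.
pose p := rep r w ++ rep (k - r) (dword k).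
pose q := rep (mult k - k.+1) (dword k).
exists (p ++ xword k ++ (q ++ fword k)).
  rewrite towerS !catA -2!catA; apply/mapP; exists (p ++ xword k ++ q).
    have -> : mult k = (r + (k - r)) + (1 + (mult k - k.+1)).
      by have := mult_gt k; lia.
    do 2?apply: cat_concats; try exact: rep_concats.
    - exact/rep_concats/dword_tower.
    - have := rep_concats 1 (xword_tower k).
      by rewrite repS cats0.
    - exact/rep_concats/dword_tower.
  by rewrite -!catA.
have sp : s + size p = j.
  rewrite size_cat !size_rep sw -/(height k).
  have : r * height k + (k - r) * height k = k * height k by rewrite -mulnDl subnKC.
  by rewrite mulnS /r; lia.
apply/hitsP; exists p, (q ++ fword k); split=> //; first by rewrite sp.
by rewrite (size_cat p) -[ltnLHS]addn0 ltn_add2l size_cat size_xword addn_gt0 height_gt0.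
Qed.

(** * Greedy elimination of patterns *)

Section Greedy.
Variables (I : finType) (Q : I -> pred nat) (v : seq bool).
Implicit Types (A : {set I}) (w : seq bool).

Definition missed A w s := [set i in A | ~~ hits v w s (Q i)].

Lemma missed_catl A w w' s : #|missed A (w ++ w') s| <= #|missed A w s|.
Proof.
apply/subset_leq_card/fintype.subsetP => i; rewrite !inE => /andP[-> /=].
exact/contra/hits_catl.
Qed.

Lemma missed_cat A w w' s :
  #|missed A (w ++ w') s| <= #|missed (missed A w s) w' (s + size w)|.
Proof.
apply/subset_leq_card/fintype.subsetP => i; rewrite !inE => /andP[-> /=].
by move=> H; apply/andP; split; apply: contra H; [exact: hits_catl|exact: hits_catr].
Qed.

(** This is the proportion [(1 - 1/M) ^ r] with denominators cleared. Uniformity in [A] and [s] is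
    what allows iteration along a concatenation. *)
Definition thins M r (l : seq (seq bool)) := forall A s, exists2 w, w \in l &
  M ^ r * #|missed A w s| <= (M - 1) ^ r * #|A|.

(** Double counting of the pairs (word, pattern hit by it): every pattern occurs in some pair, so
    some word hits at least the average share of [A]. *)
Lemma thins_pigeonhole (l : seq (seq bool)) : 0 < size l ->
  (forall i s, exists2 w, w \in l & hits v w s (Q i)) -> thins (size l) 1 l.
Proof.
move=> l0 hl A s; apply/hasP/negPn/negP => /hasPn nh.
pose h w := #|[set i in A | hits v w s (Q i)]|.
have hE w : h w + #|missed A w s| = #|A|.
  rewrite -(cardsID [set i | hits v w s (Q i)] A); congr (_ + _).
    by apply: eq_card => i; rewrite !inE.
  by apply: eq_card => i; rewrite !inE andbC.
have h_small w : w \in l -> size l * h w + 1 <= #|A|.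
  move/nh; rewrite !expn1 -ltnNge mulnBl mul1n -(hE w) => H.
  move: H; rewrite mulnDr; nia.
have : \sum_(w <- l) (size l * h w + 1) <= \sum_(w <- l) #|A|.
  by rewrite big_seq [leqRHS]big_seq leq_sum.
rewrite big_split /= sum1_size -big_distrr /= big_const_seq count_predT iter_addn_0.
suff Ah : #|A| <= \sum_(w <- l) h w.
  by rewrite mulnC => H; have := leq_mul (leqnn (size l)) Ah; lia.
under eq_bigr do rewrite /h -sum1_card big_mkcond /=.
rewrite exchange_big /= -sum1_card big_mkcond leq_sum // => i _.
case: ifP => // iA; have [w wl hw] := hl i s.
by rewrite (big_rem w) //= inE iA hw.
Qed.

(** Each factor is chosen against the patterns missed by the earlier ones, at its own starting
    position, so the proportions multiply. *)
Lemma thins_concats M r l n : thins M r l -> thins M (r * n) (concats n l).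
Proof.
move=> tl; elim: n => [|n IHn] A s.
  exists [::]; first by rewrite inE.
  rewrite muln0 !expn0 !mul1n; apply/subset_leq_card/fintype.subsetP => i.
  by rewrite inE => /andP[].
have [w wl hw] := tl A s; have [w' w'l hw'] := IHn (missed A w s) (s + size w).
exists (w ++ w'); first by apply/allpairsP; exists (w, w').
apply: (@leq_trans (M ^ (r * n.+1) * #|missed (missed A w s) w' (s + size w)|)).
  by rewrite leq_mul2l missed_cat orbT.
rewrite mulnS !expnD -!mulnA.
apply: leq_trans (_ : M ^ r * ((M - 1) ^ (r * n) * #|missed A w s|) <= _).
  by rewrite leq_mul2l hw' orbT.
by rewrite mulnCA [leqRHS]mulnCA leq_mul2l hw orbT.
Qed.

Lemma thins_map_catr M r l u : thins M r l -> thins M r [seq w ++ u | w <- l].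
Proof.
move=> tl A s; have [w wl hw] := tl A s; exists (w ++ u); first exact: map_f.
by apply: leq_trans hw; rewrite leq_mul2l missed_catl orbT.
Qed.

End Greedy.

(** The pigeonhole applies at stage [k.+1], where [hits_tower] provides a hit for each pattern. Each
    later stage [i] multiplies the exponent by [mult i], and its filler can only add hits. *)
Lemma thins_tower k L d (I : finType) (Q : I -> pred nat) :
  L <= k -> (forall i, dense_within L (Q i)) ->
  thins Q (xword k) (size (tower k.+1))
    (\prod_(k.+1 <= i < k.+1 + d) mult i) (tower (k.+1 + d)).
Proof.
move=> Lk dQ; elim: d => [|d IHd].
  rewrite addn0 big_geq //; apply: thins_pigeonhole => [|i s].
    exact: size_tower_gt0.
  exact: hits_tower Lk (dQ i).
rewrite [k.+1 + d.+1]addnS big_nat_recr ?leq_addr //= towerS.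
exact/thins_map_catr/thins_concats.
Qed.

(** * Lengths of tower words and gaps between occurrences in x *)

Definition max_length k :=
  iteri k (fun j b => mult j * b + size (fword j)) 2.

Lemma size_tower k w : w \in tower k -> size w <= max_length k.
Proof.
elim: k w => [|k IHk] w; first by rewrite !inE => /or3P[]/eqP ->.
rewrite towerS => /mapP[v vc ->]; rewrite size_cat leq_add2r.
elim: (mult k) v vc => [|n IHn] v; first by rewrite inE => /eqP ->.
case/allpairsP=> -[p q] /= [/IHk pk /IHn qn ->].
by rewrite size_cat mulSn leq_add.
Qed.

Definition built_from k w := exists2 l, all [in tower k] l & w = flatten l.

Lemma built_cat k w w' :
  built_from k w -> built_from k w' -> built_from k (w ++ w').
Proof.
move=> [l hl ->] [l' hl' ->]; exists (l ++ l'); last by rewrite flatten_cat.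
by rewrite all_cat hl.
Qed.

Lemma built_flatten k l : (forall w, w \in l -> built_from k w) ->
  built_from k (flatten l).
Proof.
elim: l => [|w l IHl] hl; first by exists [::].
apply: built_cat; first by apply: hl; rewrite mem_head.
by apply: IHl => w' w'l; apply: hl; rewrite inE w'l orbT.
Qed.

Lemma built_tower k d w : w \in tower (k + d) -> built_from k w.
Proof.
elim: d w => [|d IHd] w.
  by rewrite addn0 => wT; exists [:: w]; rewrite /= ?cats0 ?wT.
rewrite addnS towerS => /mapP[v vc ->]; apply: built_cat.
  elim: (mult _) v vc => [|n IHn] v; first by rewrite inE => /eqP ->; exists [::].
  by case/allpairsP=> -[p q] /= [/IHd pk /IHn qn ->]; exact: built_cat.
apply: built_flatten => _ /nseqP[-> _].
exact: built_flatten.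
Qed.

Lemma split_flatten (l : seq (seq bool)) b i :
  all (fun w => size w <= b) l -> i + b < size (flatten l) ->
  exists l1 w l2, l = l1 ++ w :: l2 /\ i <= size (flatten l1) <= i + b.
Proof.
elim: l i => [|v l IHl] i //= /andP[vb lb]; rewrite size_cat => ib.
have [iv|vi] := leqP i (size v).
  case: l {IHl} lb ib => [|w l] _ ib; first by move: ib; rewrite /=; lia.
  by exists [:: v], w, l; split=> //; rewrite /= cats0 iv (leq_trans vb) ?leq_addl.
have [|l1 [w [l2 [-> h]]]] := IHl (i - size v) lb; first by lia.
exists (v :: l1), w, l2; split=> //=; rewrite size_cat.
by move: h; generalize (size (flatten l1)) => m; lia.
Qed.

(** The filler that ends [v] lists all of [tower k] at least once, because [dword k] is nonempty. *)
Lemma tower_infix k v w : v \in tower k.+1 -> w \in tower k ->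
  exists p q : seq bool, v = p ++ w ++ q.
Proof.
rewrite towerS => /mapP[v' _ ->] wT.
have := height_gt0 k; rewrite /fword /filler /height.
case: (size (dword k)) => // n _.
case/splitPr: wT => t1 t2; rewrite repS flatten_cat /=.
exists (v' ++ flatten t1), (flatten t2 ++ rep n (flatten (t1 ++ w :: t2))).
by rewrite flatten_cat /= -!catA.
Qed.

(** x is a concatenation of words of [tower k.+1], each containing [w] and of length at most [b].
    One [b] in the gap reaches the start of such a factor, the other the copy of [w] in it. *)
Lemma xpoint_occurrences k w : w \in tower k ->
  exists G, forall i, exists2 j, i <= j <= i + G &
    forall n, n < size w -> xpoint (j + n) = nth false w n.
Proof.
move=> wT; set b := max_length k.+1; exists (b + b) => i.
pose J := i + b.
have Jh : i + b < size (xword (k.+1 + J)).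
  by rewrite size_xword (leq_ltn_trans _ (height_gt _)) // leq_addl.
have [l hl lE] := built_tower (xword_tower (k.+1 + J)).
have hb : all (fun w => size w <= b) l.
  by apply: sub_all hl => v; apply: size_tower.
rewrite lE in Jh; have [l1 [v [l2 [lE2 hl1]]]] := split_flatten hb Jh.
have vT : v \in tower k.+1.
  by move/allP: hl; apply; rewrite lE2 mem_cat mem_head orbT.
have [p [q vE]] := tower_infix vT wT.
exists (size (flatten l1 ++ p)).
  have : size p <= b by rewrite (leq_trans _ (size_tower vT)) // vE size_cat leq_addr.
  by rewrite size_cat; move: hl1; clear; lia.
move=> n nw; rewrite (@xpointE (k.+1 + J)); last first.
  rewrite -size_xword lE lE2 flatten_cat /= vE !size_cat.
  by rewrite -!addnA !ltn_add2l ltn_addr.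
rewrite lE lE2 flatten_cat /= vE -!catA catA nth_cat ltnNge leq_addr addKn /=.
by rewrite nth_cat nw.
Qed.

Lemma prod_mult_gt0 m n : 0 < \prod_(m <= i < n) mult i.
Proof. by rewrite prodn_gt0 // => i; exact: mult_gt0. Qed.

(** As [mult j] is [2 ^ j] times the length of the filler, the fillers contribute a convergent
    geometric sum. With [b := height] this yields positive density of the returns of y; with
    [b := max_length], a number of greedy choices proportional to the window. *)
Lemma growth_bound (b : nat -> nat) k d :
  (forall j, b j.+1 = mult j * b j + size (fword j)) ->
  b (k + d) <= (b k + 2) * \prod_(k <= i < k + d) mult i.
Proof.
(* The ratio of [b (k + d)] to the product is at most [b k + 2 - 2 / 2 ^ d]. *)
move=> bS; suff: 2 ^ d * b (k + d) + 2 * \prod_(k <= i < k + d) mult i <=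
    2 ^ d * ((b k + 2) * \prod_(k <= i < k + d) mult i).
  by move=> H; rewrite -(leq_pmul2l (expn_gt0 2 d)) (leq_trans _ H) ?leq_addr.
elim: d => [|d IHd]; first by rewrite addn0 big_geq // expn0; lia.
rewrite addnS big_nat_recr ?leq_addr //= bS.
have : 2 ^ d * size (fword (k + d)) <= mult (k + d).
  by rewrite leq_mul2r leq_pexp2l ?leq_addl // orbT.
have := prod_mult_gt0 k (k + d).
move: IHd; rewrite expnS.
move: (\prod_(_ <= i < _) mult i) (mult _) (size _) (b (k + d)) (b k) (2 ^ d).
by move=> P m u bd bk e; nia.
Qed.

(** * Block structure of y *)

Definition yblock k (c : bool) := if c then yword k else nseq (height k) false.

Lemma size_yblock k c : size (yblock k c) = height k.
Proof. by case: c; rewrite ?size_yword ?size_nseq. Qed.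

Lemma size_yblocks k c : size (flatten (map (yblock k) c)) = size c * height k.
Proof. by elim: c => //= b c IHc; rewrite size_cat size_yblock IHc mulSn. Qed.

(** [height k] divides the lengths of all later fillers, so the added zeros split into whole blocks;
    only the repetitions multiply the number of nonzero blocks. *)
Lemma yword_blocks k d : exists2 c : seq bool,
  yword (k + d) = flatten (map (yblock k) c) &
  count id c = \prod_(k <= i < k + d) mult i.
Proof.
elim: d => [|d [c cE cn]].
  by exists [:: true]; rewrite addn0 ?big_geq //= cats0.
have /dvdnP[m mE] : height k %| size (fword (k + d)).
  apply: dvdn_trans (dvdn_fword _); elim: d {c cE cn} => [|d IHd]; first by rewrite addn0.
  rewrite addnS heightS dvdn_add ?dvdn_mull //.
  exact: dvdn_trans IHd (dvdn_fword _).
exists (rep (mult (k + d)) c ++ nseq m false).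
  rewrite addnS ywordS map_cat flatten_cat map_nseq /= mE; congr (_ ++ _).
    by elim: (mult _) => // n IHn; rewrite !repS IHn cE map_cat flatten_cat.
  elim: m {mE} => // m IHm.
  by rewrite mulSn repS -IHm -nseqD.
rewrite addnS big_nat_recr ?leq_addr //= count_cat count_nseq mul0n addn0 -cn.
by rewrite count_flatten map_nseq sumn_nseq.
Qed.

Lemma nth_yblocks k c t j : j < height k ->
  nth false (flatten (map (yblock k) c)) (t * height k + j) =
  nth false c t && nth false (yword k) j.
Proof.
move=> jk; elim: c t => [|b c IHc] t; first by rewrite !nth_nil.
rewrite /= nth_cat size_yblock; case: t => [|t].
  by rewrite mul0n add0n jk; case: b => //=; rewrite nth_nseq if_same.
by rewrite mulSn -addnA ltnNge leq_addr addKn /= IHc.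
Qed.

(* A window of length [n] is coded by its offset in the subdivision into
   blocks of length [height k] and by the kinds of the blocks that it meets. *)
Definition window_word k (r : nat) (c : seq bool) (j : nat) :=
  nth false c ((r + j) %/ height k) && nth false (yword k) ((r + j) %% height k).

Lemma ypoint_window k n i :
  exists (r : 'I_(height k)) (c : (n %/ height k + 2).-tuple bool),
  forall j, j < n -> ypoint (i + j) = window_word k r c j.
Proof.
have [b bE _] := yword_blocks k (i + n).
have h0 := height_gt0 k.
exists (Ordinal (ltn_pmod i h0)),
  [tuple nth false b (i %/ height k + t) | t < n %/ height k + 2].
move=> j jn; rewrite (@ypointE (k + (i + n))); last first.
  by rewrite (leq_trans _ (height_gt _)) // ltnS; lia.
rewrite /window_word /=; set r := i %% height k.
have -> : i + j = (i %/ height k + (r + j) %/ height k) * height k + (r + j) %% height k.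
  by rewrite mulnDl -addnA -divn_eq addnA -divn_eq.
rewrite bE nth_yblocks ?ltn_mod //; congr (_ && _).
(* The two extra blocks account for the partial blocks at the two ends of the window. *)
have tn : (r + j) %/ height k < n %/ height k + 2.
  have rh : r < height k by rewrite ltn_mod.
  rewrite ltn_divLR // mulnDl; have := divn_eq n (height k).
  have := ltn_pmod n h0; lia.
by rewrite -[(r + j) %/ _]/(val (Ordinal tn)) nth_mktuple.
Qed.

(** Each block [yword k] of y after the first starts a return, and the number of such blocks is
    comparable to the length. *)
Lemma ypoint_returns k : exists2 C, 0 < C & forall d, 2 <= d ->
  exists s : seq nat, [/\ uniq s, height (k + d) <= C * size s &
    forall i, i \in s -> [/\ 0 < i, i < height (k + d) &
      forall j, j < height k -> ypoint (i + j) = ypoint j]].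
Proof.
(* [growth_bound] gives [height k + 2]. The factor 2 pays for the block at position 0, which is not
   a positive time: [P <= 2 * (P - 1)] for the product [P] of multiplicities, as [P >= 2]. *)
exists (2 * (height k + 2)); first by rewrite muln_gt0 addn_gt0 orbT.
move=> d d2; have [b bE bn] := yword_blocks k d.
have h0 := height_gt0 k.
pose s := [seq t * height k | t <- iota 1 (size b).-1 & nth false b t].
have bh : height (k + d) = size b * height k.
  by rewrite -size_yword bE size_yblocks.
exists s; split.
- rewrite map_inj_uniq ?filter_uniq ?iota_uniq // => p q /eqP.
  by rewrite eqn_pmul2r // => /eqP.
- have P2 : 2 <= \prod_(k <= i < k + d) mult i.
    case: d d2 {bE bn bh} => [|[|d]] // _.
    rewrite addnS big_nat_recr ?leq_addr //= -[leqLHS]mul1n leq_mul ?prod_mult_gt0 //.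
    by apply: leq_trans (mult_gt _); rewrite addnS.
  have ss : \prod_(k <= i < k + d) mult i <= (size s).+1.
    rewrite -bn size_map size_filter; case: (b) => //= c b'.
    have -> : count [eta nth false (c :: b')] (iota 1 (size b')) = count id b'.
      rewrite -[in RHS](take_size b') -[in RHS](drop0 b') -[drop 0 b']/(drop 1 (c :: b')).
      by rewrite -(map_nth_iota false) ?count_map //= drop0 // subSS subn0.
    by rewrite -add1n leq_add2r; case: c.
  have := @growth_bound height k d heightS; move: P2 ss.
  move: (\prod_(_ <= i < _) _) (size s) (height k) (height (k + d)).
  by move=> P m h h'; clear; nia.
- move=> _ /mapP[t + ->]; rewrite mem_filter mem_iota => /andP[bt /andP[t1 t2]].
  have tb : t < size b by case: (b) bt t2 => //=; rewrite nth_nil.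
  split=> [||j jk]; first by rewrite muln_gt0 t1.
    by rewrite bh ltn_pmul2r.
  rewrite (@ypointE (k + d)); last first.
    rewrite bh (leq_trans _ (leq_mul tb (leqnn _))) // mulSn addnC ltn_add2r.
    by [].
  by rewrite bE nth_yblocks // bt (ypointE jk).
Qed.
(** Started from all patterns, the greedy bound leaves fewer than one pattern missed. *)
Lemma tower_hits_all k L d (I : finType) (Q : I -> pred nat) :
  L <= k -> (forall i, dense_within L (Q i)) ->
  let M := size (tower k.+1) in
  let r := \prod_(k.+1 <= i < k.+1 + d) mult i in
  #|I| * (M - 1) ^ r < M ^ r ->
  exists2 w, w \in tower (k.+1 + d) & forall i, hits (xword k) w 0 (Q i).
Proof.
move=> Lk dQ M r small.
have [w wT] := @thins_tower k L d I Q Lk dQ [set: I] 0.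
rewrite -/M -/r cardsT [leqRHS]mulnC => /leq_ltn_trans/(_ small).
rewrite -[ltnRHS]muln1 ltn_mul2l => /andP[_]; rewrite ltnS leqn0 cards_eq0.
move=> /eqP missed0; exists w => // i; apply/negPn/negP => ni.
have : i \in missed Q (xword k) [set: I] w 0 by rewrite !inE ni.
by rewrite missed0 inE.
Qed.

Lemma max_lengthS k : max_length k.+1 = mult k * max_length k + size (fword k).
Proof. by []. Qed.

Lemma max_length_gt k : k < max_length k.
Proof.
apply: leq_trans (height_gt k) _.
by rewrite -size_xword size_tower // xword_tower.
Qed.

End Words.

(** * Spaces of binary sequences *)

Section SequenceSpace.
Local Open Scope classical_set_scope.
Local Open Scope ring_scope.
Import Order.TTheory GRing.Theory Num.Theory.

(* [R] is a phantom parameter: it lets the metric on [subshift R P], and hence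
   its topology, be inferred from the type. *)
Definition subshift (R : realType) (P : set (nat -> bool)) : Type :=
  {z : nat -> bool | P z}.

Definition pointwise_closed (P : set (nat -> bool)) := forall z,
  (forall n, exists2 z', P z' & forall i, (i < n)%N -> z i = z' i) -> P z.

Definition shift_invariant (P : set (nat -> bool)) :=
  forall z, P z -> P (fun n => z n.+1).

HB.instance Definition _ (R : realType) P := gen_eqMixin (subshift R P).
HB.instance Definition _ (R : realType) P := gen_choiceMixin (subshift R P).

Context (R : realType) (P : set (nat -> bool)).
Local Notation Z := (subshift R P).
Implicit Types u v w : Z.

Definition first_diff_dist u v : R :=
  if pselect (exists n, sval u n != sval v n) is left h then 2 ^- ex_minn h else 0.

Definition agree n u v := forall i, (i < n)%N -> sval u i = sval v i.

Lemma le_first_diff_dist n u v : sval u n != sval v n -> 2 ^- n <= first_diff_dist u v.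
Proof.
rewrite /first_diff_dist => uv; case: pselect => [h|[]]; last by exists n.
case: ex_minnP => m _ /(_ _ uv) mn.
by rewrite lef_pV2 ?posrE ?exprn_gt0 // ler_eXn2l // ltr1n.
Qed.

Lemma first_diff_dist_le n u v : (first_diff_dist u v <= 2 ^- n) <-> agree n u v.
Proof.
split=> [d i ni|uv].
  apply/eqP/negPn/negP => /le_first_diff_dist di.
  have := le_trans di d; rewrite lef_pV2 ?posrE ?exprn_gt0 // ler_eXn2l ?ltr1n //.
  by rewrite leqNgt ni.
rewrite /first_diff_dist; case: pselect => [h|_]; last by rewrite invr_ge0 exprn_ge0.
case: ex_minnP => m; case: (leqP n m) => [nm _ _|/uv ->]; last by rewrite eqxx.
by rewrite lef_pV2 ?posrE ?exprn_gt0 // ler_eXn2l // ltr1n.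
Qed.

Lemma first_diff_dist_ge0 u v : 0 <= first_diff_dist u v.
Proof.
by rewrite /first_diff_dist; case: pselect => // h; rewrite invr_ge0 exprn_ge0.
Qed.

Lemma first_diff_distxx u : first_diff_dist u u = 0.
Proof.
by rewrite /first_diff_dist; case: pselect => // h; have [n] := h; rewrite eqxx.
Qed.

Lemma first_diff_dist_eq0 u v : first_diff_dist u v = 0 -> u = v.
Proof.
move=> d0; apply: eq_sig_hprop => [z p q|]; first exact: Prop_irrelevance.
apply/funext => n; apply/eqP/negPn/negP => /le_first_diff_dist.
by rewrite d0 leNgt invr_gt0 exprn_gt0.
Qed.

Lemma first_diff_dist_sym u v : first_diff_dist u v = first_diff_dist v u.
Proof.
suff H u' v' : first_diff_dist u' v' <= first_diff_dist v' u'.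
  by apply/eqP; rewrite eq_le !H.
rewrite {1}/first_diff_dist; case: pselect => [h|_]; last exact: first_diff_dist_ge0.
by case: ex_minnP => m mP _; apply: le_first_diff_dist; rewrite eq_sym.
Qed.

Lemma first_diff_dist_triangle v u w :
  first_diff_dist u w <= first_diff_dist u v + first_diff_dist v w.
Proof.
rewrite {1}/first_diff_dist; case: pselect => [h|_]; last first.
  by rewrite addr_ge0 ?first_diff_dist_ge0.
case: ex_minnP => m mP _; have [uv|/le_first_diff_dist] := eqVneq (sval u m) (sval v m).
  rewrite uv in mP; apply: le_trans (le_first_diff_dist mP) _.
  by rewrite lerDr first_diff_dist_ge0.
by move/le_trans; apply; rewrite lerDl first_diff_dist_ge0.
Qed.

HB.instance Definition _ := isMetric.Build R Z first_diff_distxx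
  first_diff_dist_eq0 first_diff_dist_sym first_diff_dist_triangle.

Lemma nbhs_subshiftP u (U : set Z) :
  nbhs u U <-> exists n, [set v | agree n u v] `<=` U.
Proof.
rewrite -nbhs_ballE; split=> [[e /= e0 eU]|[n nU]].
  have [n _ /(_ n (leqnn n)) ne] := near_infty_natSinv_expn_lt (PosNum e0).
  exists n => v /first_diff_dist_le uv; apply: eU; rewrite ballEmdist /=.
  by apply: le_lt_trans uv _; move: ne; rewrite /= div1r.
exists (2 ^- n); first by rewrite /= invr_gt0 exprn_gt0.
move=> v; rewrite ballEmdist /= => /ltW /first_diff_dist_le; exact: nU.
Qed.

Lemma nbhs_agree n u : nbhs u [set v | agree n u v].
Proof. by apply/nbhs_subshiftP; exists n. Qed.

Lemma agree_trans n u v w : agree n u v -> agree n v w -> agree n u w.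
Proof. by move=> uv vw i ni; rewrite uv // vw. Qed.

Lemma agree_leq m n u v : (m <= n)%N -> agree n u v -> agree m u v.
Proof. by move=> mn uv i im; rewrite uv // (leq_trans im). Qed.

Hypothesis P_closed : pointwise_closed P.

(** An ultrafilter decides every coordinate; the sequence of decided values is its limit and lies in
    [P] by closedness. *)
Lemma compact_subshift : compact [set: Z].
Proof.
rewrite compact_ultra => F FU _.
pose z i := `[< F [set u : Z | sval u i] >].
have Fz i : F [set u : Z | sval u i = z i].
  rewrite /z; case: asboolP => [//|nF].
  have [//|] := in_ultra_setVsetC [set u : Z | sval u i] FU.
  by apply: filterS => u /= /negP/negbTE.
have Fagree n : F [set u : Z | forall i, (i < n)%N -> z i = sval u i].
  elim: n => [|n IHn]; first exact: filterS filterT.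
  apply: filterS (filterI IHn (Fz n)) => u [/= un uz] i.
  by rewrite ltnS leq_eqVlt => /predU1P[->|/un].
have Pz : P z.
  apply: P_closed => n; have [u zu] := filter_ex (Fagree n).
  by exists (sval u) => //; exact: proj2_sig u.
exists (exist _ z Pz); split=> // U /nbhs_subshiftP[n nU].
exact: filterS nU (Fagree n).
Qed.

Hypothesis P_shift : shift_invariant P.

Definition shift_map (u : Z) : Z := exist _ _ (P_shift (proj2_sig u)).

Lemma iter_shift_map n u i : sval (iter n shift_map u) i = sval u (n + i)%N.
Proof. by elim: n i => // n IHn i; rewrite iterS /= IHn addnS. Qed.

Lemma continuous_shift_map : continuous shift_map.
Proof.
move=> u U /nbhs_subshiftP[n nU]; apply/nbhs_subshiftP; exists n.+1 => v uv.
by apply: nU => i ni; exact: uv.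
Qed.

(** Lebesgue number lemma: a cluster point of counterexamples [b c] lies in some member of the cover
    together with a cylinder around it, which contradicts the choice of [b c] for large [c]. *)
Lemma lebesgue_agree (C : set (set Z)) : open_cover C ->
  exists c, forall u, exists2 V, C V & [set v | agree c u v] `<=` V.
Proof.
case=> oC cC; apply: contrapT => /forallNP nC.
have /choice[b bP] : forall c, exists u, forall V, C V -> ~ [set v | agree c u v] `<=` V.
  move=> c; have /existsNP[u uP] := nC c; exists u => V CV uV.
  by apply: uP; exists V.
have [v [_ vb]] := @compact_subshift (b @ \oo) _ filterT.
have : [set: Z] v by [].
rewrite -cC => -[V CV Vv].
have /nbhs_subshiftP[n nV] : nbhs v V by apply: open_nbhs_nbhs; split=> //; exact: oC.
have bn : (b @ \oo) [set b c | c in [set c | (n <= c)%N]].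
  by exists n => // c /= nc; exists c.
have [_ [[c nc <-] vc]] := vb _ _ bn (nbhs_agree n v).
apply: (bP c V CV) => w cw; apply: nV; exact: agree_trans vc (agree_leq nc cw).
Qed.
End SequenceSpace.

(** * Entropy *)

Section CoverNumber.
Local Open Scope classical_set_scope.
Implicit Types X : Type.

Lemma cover_numberP X (C : set (set X)) j : subcover_sizes C j ->
  subcover_sizes C (cover_number C) /\ (cover_number C <= j)%N.
Proof.
move=> Cj; have h : exists k, `[< subcover_sizes C k >] by exists j; apply/asboolP.
have [|Cm mP] := @xgetPex _ 0%N [set k | subcover_sizes C k /\
    forall j, subcover_sizes C j -> (k <= j)%N]; last by split=> //; exact: mP.
exists (ex_minn h); case: ex_minnP => m /asboolP Cm mP; split=> // i Ci.
by apply: mP; apply/asboolP.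
Qed.

(** The set [A] discards indices whose [E i] need not belong to [C], such as codes realized by no
    point. *)
Lemma cover_number_le X (C : set (set X)) (K : finType) (E : K -> set X) (A : set K) :
  (forall i, A i -> C (E i)) -> cover A E = [set: X] ->
  subcover_sizes C (cover_number C) /\ (cover_number C <= #|K|)%N.
Proof.
move=> CE cE.
have fA : finite_set (E @` A) by apply: finite_image; exact: finite_finset.
have [n nE] := (finite_setP _).1 fA.
have [|H1 H2] := @cover_numberP X C n.
  exists (E @` A); split=> //; first by move=> _ [i Ai <-]; exact: CE.
  rewrite -cE; apply/seteqP; split=> x; first by case=> _ [i Ai <-] Eix; exists i.
  by case=> i Ai Eix; exists (E i) => //; exists i.
split=> //; apply: leq_trans H2 _; rewrite -card_le_II.
rewrite -(card_le_eql nE); apply: card_le_trans (card_image_le _ _) _.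
apply: card_le_trans (card_leT _) _.
apply/pcard_leP/injfunPex; exists (fun i => enum_rank i : nat) => [i _|i j _ _ ij].
  exact: ltn_ord.
exact/enum_rank_inj/val_inj.
Qed.

Lemma finite_subcover_sizes X (C : set (set X)) :
  finite_set C -> cover C id = [set: X] -> exists j, subcover_sizes C j.
Proof. by move=> /finite_setP[j Cj] cC; exists j, C; split. Qed.

Lemma finite_iterated_join X (f : X -> X) (C : set (set X)) n :
  finite_set C -> finite_set (iterated_join f C n).
Proof.
move=> fC; elim: n => [|n IHn].
  apply: sub_finite_set (finite_set1 [set: X]) => _ [V _ <-].
  by rewrite /= bigcap_mkord big_ord0.
apply: sub_finite_set
  (finite_image2 (fun A B : set X => A `&` (iter n f @^-1` B)) IHn fC).
move=> _ [V CV <-]; exists (\bigcap_(i < n) (iter i f @^-1` V i)); first by exists V.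
exists (V n); first exact: CV.
by rewrite /= !bigcap_mkord big_ord_recr.
Qed.

Lemma cover_iterated_join X (f : X -> X) (C : set (set X)) n :
  cover C id = [set: X] -> cover (iterated_join f C n) id = [set: X].
Proof.
move=> cC; apply/seteqP; split=> // x _.
have /choice[V VP] : forall i, exists V, C V /\ V (iter i f x).
  move=> i; have : [set: X] (iter i f x) by [].
  by rewrite -cC => -[V CV Vx]; exists V.
exists (\bigcap_(i < n) (iter i f @^-1` V i)).
  by exists V => // i; have [] := VP i.
by move=> i _; have [] := VP i.
Qed.
End CoverNumber.

Section Entropy.
Local Open Scope classical_set_scope.
Local Open Scope ring_scope.
Import Order.TTheory GRing.Theory Num.Theory.
Variable R : realType.

Lemma limf_esup_le (T : choiceType) (X : filteredType T) (f : X -> \bar R)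
    (F : set (set X)) (e : \bar R) :
  F [set x | (f x <= e)%E] -> (limf_esup f F <= e)%E.
Proof.
move=> Fe; rewrite /limf_esup.
apply: (@le_trans _ _ (ereal_sup (f @` [set x | (f x <= e)%E]))).
  by apply: ereal_inf_lbound; exists [set x | (f x <= e)%E].
by apply: ge_ereal_sup => _ [x fx <-].
Qed.

Lemma limf_esup_ge (T : choiceType) (X : filteredType T) (f : X -> \bar R)
    (F : set (set X)) (e : \bar R) :
  (forall A, F A -> exists2 x, A x & (e <= f x)%E) -> (e <= limf_esup f F)%E.
Proof.
move=> Fe; rewrite /limf_esup; apply: le_ereal_inf_tmp => _ [A /Fe[x Ax fx] <-].
by apply: le_trans fx _; apply: ereal_sup_ubound; exists x.
Qed.

Lemma cover_entropy_ge0 X (f : X -> X) C : (0 <= cover_entropy R f C)%E.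
Proof.
apply: limf_esup_ge => A /filter_ex[n An]; exists n => //.
rewrite lee_fin divr_ge0 //; case: (cover_number _) => [|k]; first by rewrite ln0.
by rewrite ln_ge0 // ler1n.
Qed.

Lemma topological_entropy_eq0 (X : topologicalType) (f : X -> X) :
  (forall C e, open_cover C -> 0 < e -> (cover_entropy R f C <= e%:E)%E) ->
  topological_entropy R f = 0%E.
Proof.
move=> fC; apply/eqP; rewrite eq_le; apply/andP; split.
  apply: ge_ereal_sup => _ [C CC <-]; apply/lee_addgt0Pr => e e0.
  by rewrite add0e; exact: fC.
(* The trivial cover shows that the supremum is over a nonempty set, hence nonnegative. *)
have C1 : open_cover [set [set: X]].
  split=> [_ ->|]; first exact: openT.
  by apply/seteqP; split=> // x _; exists [set: X].
apply: le_trans (cover_entropy_ge0 f [set [set: X]]) _.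
by apply: ereal_sup_ubound; exists [set [set: X]].
Qed.

Lemma cover_number_subexp (X : topologicalType) (f : X -> X) C e :
  topological_entropy R f = 0%E -> open_cover C -> 0 < e ->
  \forall n \near \oo, (cover_number (iterated_join f C n))%:R <= expR (e * n%:R) :> R.
Proof.
move=> f0 CC e0; have : (cover_entropy R f C < e%:E)%E.
  apply: (@le_lt_trans _ _ 0%E); last by rewrite lte_fin.
  by rewrite -f0; apply: ereal_sup_ubound; exists C.
move/ereal_inf_lt => [_ [A FA <-] Ae]; near=> n.
have n0 : (0 < n)%N by near: n; exists 1%N.
have An : A n by near: n.
have : ((ln (cover_number (iterated_join f C n))%:R / n%:R : R)%:E < e%:E)%E.
  by apply: le_lt_trans Ae; apply: ereal_sup_ubound; exists n.
rewrite lte_fin ltr_pdivrMr ?ltr0n // => /ltW.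
case: (cover_number _) => [|k]; first by rewrite expR_ge0.
by move=> kn; rewrite -ler_expR lnK ?posrE ?ltr0n // in kn.
Unshelve. all: by end_near. Qed.

Variable P : set (nat -> bool).
Local Notation Z := (subshift R P).
Hypothesis P_closed : pointwise_closed P.
Hypothesis P_shift : shift_invariant P.

(** If [c] is a Lebesgue number of the cover, the first [n + c] letters of a point determine [c]
    letters of each of its first [n] iterates. One code thus selects one member of the join. *)
Lemma subshift_entropy_eq0 : P !=set0 ->
  (forall e : R, 0 < e ->
     \forall n \near \oo, exists (K : finType) (w : K -> nat -> bool),
     #|K|%:R <= expR (e * n%:R) /\
     forall z, P z -> exists k, forall j, (j < n)%N -> z j = w k j) ->
  topological_entropy R (@shift_map R P P_shift) = 0%E.
Proof.
move=> [z0 Pz0] codes; apply: topological_entropy_eq0 => C e CC e0.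
have [c cP] := lebesgue_agree P_closed CC.
have /choice[V VP] : forall u : Z, exists V, C V /\ [set v | agree c u v] `<=` V.
  by move=> u; have [V CV Vu] := cP u; exists V.
(* The rate is halved because the windows have length [n + c], at most [2 * n] once [c <= n]. *)
have [N _ Ncodes] := codes (e / 2) (divr_gt0 e0 (ltr0Sn _ _)).
apply: limf_esup_le; exists (maxn 1 (maxn N c)) => // n /=.
rewrite !geq_max => /and3P[n1 Nn cn].
have [K [w [Kn wP]]] := Ncodes (n + c)%N (leq_trans Nn (leq_addr _ _)).
pose A := [set k : K | exists u : Z, forall j, (j < n + c)%N -> sval u j = w k j].
have /choice[z zP] : forall k, exists u : Z,
    A k -> forall j, (j < n + c)%N -> sval u j = w k j.
  move=> k; have [[u uk]|nk] := pselect (A k); first by exists u.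
  by exists (exist _ z0 Pz0).
pose s := @shift_map R P P_shift.
pose E k := \bigcap_(i < n) (iter i s @^-1` V (iter i s (z k))).
have [||_ H] := @cover_number_le _ (iterated_join s C n) K E A.
- move=> k _; exists (fun i => V (iter i s (z k))) => // i.
  by have [] := VP (iter i s (z k)).
- apply/seteqP; split=> // u _; have [k uk] := wP _ (proj2_sig u).
  have Ak : A k by exists u.
  exists k => // i /= ni.
  have [_] := VP (iter i s (z k)); apply=> j jc.
  by rewrite !iter_shift_map (zP _ Ak) ?uk //; lia.
rewrite lee_fin ler_pdivrMr ?ltr0n //.
have : #|K|%:R <= expR (e * n%:R).
  apply: le_trans Kn _; rewrite ler_expR natrD mulrDr.
  have : e / 2 * c%:R <= e / 2 * n%:R by rewrite ler_wpM2l ?ler_nat // divr_ge0 // ltW.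
  lra.
case: (cover_number _) H => [|m] mK Ke; first by rewrite ln0 // mulr_ge0 // ltW.
rewrite -ler_expR lnK ?posrE ?ltr0n //; apply: le_trans Ke.
by rewrite ler_nat.
Qed.
End Entropy.

(** * The two points *)

Section TwoPoints.
Local Open Scope classical_set_scope.
Local Open Scope ring_scope.
Import Order.TTheory GRing.Theory Num.Theory.
Variable R : realType.

(** The orbit closure of [y] under the shift, expressed through prefixes of its points. *)
Definition language_of (y z : nat -> bool) :=
  forall n, exists i, forall j, (j < n)%N -> z j = y (i + j)%N.

Lemma language_of_closed y : pointwise_closed (language_of y).
Proof.
move=> z H n; have [z' /(_ n)[i iP] zz'] := H n.
by exists i => j jn; rewrite zz' // iP.
Qed.

Lemma language_of_shift y : shift_invariant (language_of y).
Proof.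
move=> z H n; have [i iP] := H n.+1; exists i.+1 => j jn.
by rewrite iP // addnS.
Qed.

Lemma language_of_self y : language_of y y.
Proof. by move=> n; exists 0%N. Qed.

Local Notation Y := (subshift R (language_of ypoint)).
Local Notation g := (@shift_map R _ (@language_of_shift ypoint)).
Definition ypt : Y := exist _ ypoint (language_of_self ypoint).

Local Notation X := (subshift R setT).
Definition full_shift : X -> X := @shift_map R setT (fun _ _ => Logic.I).
Definition xpt : X := exist _ xpoint Logic.I.

Lemma ypoint_windows (e : R) : 0 < e ->
  \forall n \near \oo, exists (K : finType) (w : K -> nat -> bool),
     #|K|%:R <= expR (e * n%:R) /\
     forall z, language_of ypoint z -> exists k, forall j, (j < n)%N -> z j = w k j.
Proof.
(* With [2 / e < height k], half of [e] bounds [2 ^ (n %/ height k)]; the other half absorbs the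
   constant [4 * height k] for large [n]. *)
move=> e0; pose k := Num.truncn (2 / e).
have ke : 2 / e < (height k)%:R.
  apply: lt_le_trans (truncnS_gt _) _.
  by rewrite ler_nat height_gt.
have h0 : 0 < (height k)%:R :> R by rewrite ltr0n height_gt0.
near=> n; exists ('I_(height k) * (n %/ height k + 2).-tuple bool)%type.
exists (fun rc : 'I_(height k) * (n %/ height k + 2).-tuple bool =>
  window_word k rc.1 rc.2); split; last first.
  move=> z /(_ n)[i iP]; have [r [c rcP]] := ypoint_window k n i.
  by exists (r, c) => j jn; rewrite iP // rcP.
rewrite card_prod card_ord card_tuple card_bool natrM natrX exprD.
have e1 : 2 <= expR 1 :> R by apply: le_trans (expR_ge1Dx 1); lra.
have -> : e * n%:R = e / 2 * n%:R + e / 2 * n%:R :> R by lra.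
rewrite expRD [2 ^+ _ * _]mulrC mulrA; apply: ler_pM.
- by rewrite mulr_ge0 ?(ltW h0).
- by rewrite exprn_ge0.
- apply: le_trans (expR_ge1Dx _).
  apply: le_trans (_ : e / 2 * n%:R <= _); last lra.
  rewrite -ler_pdivrMl ?divr_gt0 //.
  near: n; exact: nbhs_infty_ger.
apply: (@le_trans _ _ (expR 1 ^+ (n %/ height k))).
  by rewrite lerXn2r // nnegrE // expR_ge0.
rewrite -expRM_natl ler_expR mulr1.
apply: (@le_trans _ _ (n%:R / (height k)%:R)).
  by rewrite ler_pdivlMr // -natrM ler_nat leq_divM.
rewrite mulrC ler_wpM2r // -[e / 2]invrK lef_pV2 ?posrE ?invr_gt0 ?divr_gt0 //.
by rewrite invf_div ltW.
Unshelve. all: by end_near. Qed.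

Lemma ypt_entropy : topological_entropy R g = 0%E.
Proof.
apply: subshift_entropy_eq0; first exact: language_of_closed.
  by exists ypoint; exact: language_of_self.
exact: ypoint_windows.
Qed.

Lemma shift_is_tds P (cP : pointwise_closed P) (sP : shift_invariant P)
    (u v : subshift R P) :
  u <> v -> is_tds (shift_map (R := R) sP).
Proof.
by move=> uv; split; [exact: compact_subshift|exists u, v|exact: continuous_shift_map].
Qed.

Lemma ypt_recurrent : F_recurrent (F_pubd R) g ypt.
Proof.
move=> U /nbhs_subshiftP[n nU]; rewrite /F_pubd /=.
have [c c0 cP] := ypoint_returns n.
apply: (@lt_le_trans _ _ ((c%:R^-1 : R)%:E)); first by rewrite lte_fin invr_gt0 ltr0n.
apply: limf_esup_ge => A [N _ NA].
(* The summand [N] makes the initial window long enough to belong to [A]; 2 is the least stage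
   difference allowed by [ypoint_returns]. *)
have [|s [us hs sP]] := cP (N + 2)%N; first by rewrite leq_addl.
set h := height _ in hs sP; have h0 : (0 < h)%N := height_gt0 _.
exists (0%N, h.-1).
  apply: NA => /=; rewrite add0n -ltnS prednK //.
  by apply: leq_trans (height_gt _); rewrite ltnS; lia.
rewrite lee_fin subn0 prednK // ler_pdivlMr ?ltr0n // ler_pdivrMl ?ltr0n //.
rewrite -natrM ler_nat; apply: leq_trans hs _; rewrite leq_mul2l; apply/orP; right.
apply: uniq_leq_size => // i /sP[i0 ih iy].
rewrite in_fset_set; last first.
  apply: sub_finite_set (finite_II h) => j [_] /=.
  by rewrite -ltnS prednK.
rewrite inE; split; last by rewrite /= -ltnS prednK.
split=> //; apply: nU => j jn; rewrite iter_shift_map.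
by rewrite /= iy // (leq_trans jn) // ltnW // height_gt.
Qed.

Lemma iter_prod_map (A B : Type) (a : A -> A) (b : B -> B) n p :
  iter n (prod_map a b) p = (iter n a p.1, iter n b p.2).
Proof. by elim: n => [|n IHn]; [case: p | rewrite /= IHn]. Qed.

(** Both points begin with the letter 1 and never show it together at a positive time, so fixing the
    first letters suffices. *)
Lemma not_recurrent_xpt_ypt : ~ recurrent (prod_map full_shift g) (xpt, ypt).
Proof.
move=> /(_ ([set u | agree 1 xpt u] `*` [set v | agree 1 ypt v])) [].
  exists ([set u | agree 1 xpt u], [set v | agree 1 ypt v]) => //.
  by split; exact: nbhs_agree.
move=> n [n0]; rewrite iter_prod_map => -[/(_ 0%N isT) + /(_ 0%N isT)].
rewrite !iter_shift_map /= addn0 => xn yn.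
by have := xpoint_ypoint_disjoint n0; rewrite -xn -yn.
Qed.

End TwoPoints.

(** * Product recurrence of x *)

Section Recurrence.
Local Open Scope classical_set_scope.
Local Open Scope ring_scope.
Import Order.TTheory GRing.Theory Num.Theory.
Variable R : realType.

(** [(1 - 1/M) ^ r <= exp (- r / M)], while this choice of [e] keeps [N] below
    [exp (r / (2 * M))]. *)
Lemma subexp_lt (M r N : nat) (e : R) (n c : nat) :
  (0 < M)%N -> (0 < r)%N -> (0 < c)%N ->
  (n <= c * r)%N -> e = (2 * M%:R * c%:R)^-1 -> N%:R <= expR (e * n%:R) ->
  (N * (M - 1) ^ r < M ^ r)%N.
Proof.
move=> M0 r0 c0 ncr -> Ne; rewrite -(ltr_nat R) natrM !natrX.
have M0' : 0 < M%:R :> R by rewrite ltr0n.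
have c0' : 0 < c%:R :> R by rewrite ltr0n.
have r0' : 0 < r%:R :> R by rewrite ltr0n.
have N2 : N%:R <= expR (r%:R / (2 * M%:R)) :> R.
  apply: le_trans Ne _; rewrite ler_expR.
  have : n%:R <= c%:R * r%:R :> R by rewrite -natrM ler_nat.
  rewrite -(ler_pM2l (_ : 0 < (2 * M%:R * c%:R)^-1)) ?invr_gt0 ?mulr_gt0 //.
  move/le_trans; apply; rewrite le_eqVlt; apply/orP; left; apply/eqP; field.
  by rewrite !gt_eqF.
have M1 : (M - 1)%:R <= M%:R * expR (- M%:R^-1) :> R.
  rewrite natrB //; apply: (@le_trans _ _ (M%:R * (1 - M%:R^-1))).
    by rewrite mulrBr mulr1 divff // gt_eqF.
  by rewrite ler_pM2l //; exact: expR_ge1Dx.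
apply: (@le_lt_trans _ _ (expR (r%:R / (2 * M%:R)) * (M%:R * expR (- M%:R^-1)) ^+ r)).
  apply: ler_pM => //.
  by rewrite lerXn2r // nnegrE // mulr_ge0 ?expR_ge0 // ltW.
rewrite exprMn mulrCA -[ltRHS]mulr1 ltr_pM2l ?exprn_gt0 //.
rewrite -expRM_natl -expRD expR_lt1.
have -> : r%:R / (2 * M%:R) + r%:R * - M%:R^-1 = - (r%:R / (2 * M%:R)) :> R.
  by field; rewrite gt_eqF.
by rewrite oppr_lt0 divr_gt0 // mulr_gt0.
Qed.

Lemma xpt_F_ps_PR0 : F_PR0 F_ps (@full_shift R) (xpt R).
Proof.
move=> Y g _ h0 y yrec U [[A B] /= [/nbhs_subshiftP[n nA] nB] ABU].
have [e /= e0 eB] : exists2 e : R, 0 < e & ball y e `<=` interior B.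
  by have := nbhs_interior nB; rewrite -nbhs_ballE => -[e e0 eB]; exists e.
pose Vo := interior B; pose V1 := closure (ball y (e / 2)).
have V1Vo : V1 `<=` Vo by move=> z /subset_closure_half zy; apply: eB; exact: zy.
have [S [T [[L L0 SL] Tthick PE]]] : piecewise_syndetic (return_times g y V1).
  apply: yrec; apply: filterS (@subset_closure _ _) _.
  by apply: nbhsx_ballx; rewrite divr_gt0.
have retP m : S m -> T m -> V1 (iter m g y).
  by move=> Sm Tm; have : (S `&` T) m by []; rewrite -PE => -[].
(* A point of [V1] belongs to [Vo] only, so any pattern coding an orbit shows [Vo] at every visit to
   [V1]. Conversely each [Vo] in the pattern is a visit to [B]. *)
pose C : set (set Y) := [set Vo; ~` V1].
have C_cover : open_cover C.
  split=> [_ [->|->]|].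
  - exact: open_interior.
  - by rewrite openC; exact: closed_closure.
  apply/seteqP; split=> // z _; have [V1z|nV1z] := pselect (V1 z).
    by exists Vo; [left|exact: V1Vo].
  by exists (~` V1); [right|].
(* [k >= n] makes the prefix [xword k] force entry into [A], and [k >= L] is required by
   [hits_tower]. The constant [c] is that of [growth_bound] for [max_length]. *)
pose k := maxn n L; pose M := size (tower k.+1); pose c := (max_length k.+1 + 2)%N.
have M0 : (0 < M)%N := size_tower_gt0 _.
have c0 : (0 < c)%N by rewrite /c addn2.
have ep0 : 0 < (2 * M%:R * c%:R)^-1 :> R by rewrite invr_gt0 !mulr_gt0 // ltr0n.
have [N0 _ N0P] := cover_number_subexp h0 C_cover ep0.
(* [l] bounds the words of [tower (k.+1 + N0)], so hits fall inside the window; it exceeds [N0], so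
   the entropy estimate holds for it. *)
pose l := max_length (k.+1 + N0).
have lN0 : (N0 <= l)%N.
  by apply: leq_trans (ltnW (max_length_gt _)); rewrite leq_addl.
have {N0P} NP := N0P _ lN0; pose J := iterated_join g C l.
have finC : finite_set C by exact: finite_set2.
have [j0 Jj0] := finite_subcover_sizes (finite_iterated_join g l finC)
  (cover_iterated_join g l C_cover.2).
have [[D [DJ Dcard Dcover]] _] := cover_numberP Jj0.
move: NP Dcard; rewrite -/J; set N := cover_number J => NP Dcard.
have [f [fD _ fsurj]] : exists f : nat -> set Y, set_bij `I_N D f.
  by move: Dcard; rewrite card_eq_sym => /card_set_bijP.
have /choice[V VP] : forall i : 'I_N, exists V : nat -> set Y,
    (forall j, C (V j)) /\ \bigcap_(j < l) (iter j g @^-1` V j) = f i.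
  by move=> i; have /DJ[V CV VE] := fD i (ltn_ord i); exists V.
(* Adding the positions beyond the window, and all positions for the patterns
   with large gaps, makes every pattern dense without creating spurious hits. *)
pose Q0 (i : 'I_N) (j : nat) := (l <= j)%N || `[< V i j = Vo >].
pose Q i j := ~~ `[< dense_within L (Q0 i) >] || Q0 i j.
have dQ i : dense_within L (Q i).
  rewrite /Q; case: asboolP => [d|_] t; last by exists t; rewrite // leqnn leq_addr.
  by have [j jt Qj] := d t; exists j.
have Lk : (L <= k)%N by rewrite leq_maxr.
have small : (#|'I_N| * (M - 1) ^ (\prod_(k.+1 <= i < k.+1 + N0) mult i) <
    M ^ (\prod_(k.+1 <= i < k.+1 + N0) mult i))%N.
  rewrite card_ord; apply: subexp_lt M0 (prod_mult_gt0 _ _) c0 _ erefl NP.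
  exact: growth_bound max_lengthS.
have [w wT whits] := tower_hits_all Lk dQ small.
have [G GP] := xpoint_occurrences wT.
(* The run of [T] covers the wait for an occurrence of [w] in x and the window of length [l] that
   follows. Waiting from [i0.+1] makes the return time positive. *)
have [i0 i0T] := Tthick (G + l + L + 2)%N.
have [m /andP[m1 m2] wm] := GP i0.+1.
have [i fi] : exists i : 'I_N, f i (iter m g y).
  have : [set: Y] (iter m g y) by [].
  rewrite -Dcover => -[W DW Wm]; have [i iN fiW] := fsurj _ DW.
  by exists (Ordinal iN); rewrite /= fiW.
have [CV VE] := VP i.
have Vi j : (j < l)%N -> V i j (iter (m + j) g y).
  by move=> jl; move: fi; rewrite -VE => /(_ j jl) /=; rewrite -iterD addnC.
(* For the pattern followed by the orbit from time [m], the gaps of [S] give density, so a hit of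
   [Q i] is a genuine hit of [Q0 i]. *)
have Qi : dense_within L (Q0 i).
  move=> t; have [tl|lt] := leqP l (t + L)%N.
    by exists (t + L)%N; rewrite /Q0 ?leq_addr ?leqnn ?tl.
  have [j /andP[j1 j2] Sj] := SL (m + t)%N.
  exists (j - m)%N; first by lia.
  have Tj : T j.
    have -> : j = (i0 + (j - i0))%N by lia.
    by apply: i0T; lia.
  rewrite /Q0; apply/orP; right; apply/asboolP.
  have [//|nV1] := CV (j - m)%N.
  have jl : (j - m < l)%N by lia.
  have := Vi _ jl; rewrite nV1 subnKC; last by lia.
  by case; exact: retP.
have /hitsP[p [q [wE Qp pw]]] := whits i.
have pl : (size p < l)%N by apply: leq_trans pw (size_tower wT).
exists (m + size p)%N; split; first by lia.
apply: ABU; rewrite iter_prod_map; split; last first.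
  apply: interior_subset; move: Qp; rewrite /Q add0n asboolT //= /Q0 leqNgt pl /=.
  by move=> /asboolP; rewrite -/Vo => <-; exact: Vi.
apply: nA => j jn; rewrite iter_shift_map /=.
have jk : (j < height k)%N.
  by apply: leq_trans jn _; apply: leq_trans (ltnW (height_gt k)); rewrite leq_maxl.
rewrite -addnA wm; last first.
  by rewrite wE !size_cat size_xword ltn_add2l ltn_addr.
rewrite wE nth_cat ltnNge leq_addr addKn nth_cat size_xword jk.
exact: xpointE.
Qed.

End Recurrence.

Theorem theorem1p2 (R : realType) :
  exists (X : metricType R) (f : X -> X) (x : X),
    [/\ is_tds f, F_PR0 F_ps f x & ~ F_PR0 (F_pubd R) f x].
Proof.
exists (subshift R setT), (@full_shift R), (xpt R); split.
- apply: (@shift_is_tds R setT _ _ (exist _ (fun=> true) I)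
    (exist _ (fun=> false) I)) => //.
  by case=> /(congr1 (fun z => z 0)).
- exact: xpt_F_ps_PR0.
move=> /(_ _ (@shift_map R _ (@language_of_shift ypoint))) H.
apply: not_recurrent_xpt_ypt; apply: H; last exact: ypt_recurrent.
  (* The system of y is nontrivial: shifting y to a letter 0 gives a second point. *)
  have [j yj] := ypoint_false.
  apply: (@shift_is_tds R _ (@language_of_closed ypoint) _ (ypt R)
    (iter j (shift_map (@language_of_shift ypoint)) (ypt R)));
    move=> /(congr1 (fun z => sval z 0)).
  by rewrite iter_shift_map addn0 /= yj.
exact: ypt_entropy.
Qed.
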